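(* Let $(G,\mathcal{P})$ be a group pair and let $\mathcal{K}(G,\mathcal{P})$ be its coset intersection complex. (1) $\mathcal{K}(G,\mathcal{P})$ is finite dimensional if and only if $\mathcal{P}$ has finite height in $G$. (2) The cardinality of cliques in $\mathcal{K}(G,\mathcal{P})$ is bounded if and only if $\mathcal{P}$ has finite width in $G$. (3) $\mathcal{K}(G,\mathcal{P})$ has $G$-cocompact $1$-skeleton if and only if $\mathcal{P}$ has fenced infinite intersections in $G$. (4) $\mathcal{K}(G,\mathcal{P})$ is $G$-cocompact if and only if $(G,\mathcal{P})$ has finite height and a finite commensurated core. (5) $\mathcal{K}(G,\mathcal{P})$ is zero dimensional if and only if $\mathcal{P}$ is almost malnormal in $G$. (6) $\mathcal{P}$ is non-empty and $\mathcal{K}(G,\mathcal{P})$ has a connected and $G$-cocompact subgraph with vertex set $G/\mathcal{P}$ if and only if $(G,\mathrm{dist}_G)$ is a network with respect to the collection $G/\mathcal{P}$.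
   Context: A group pair $(G,\mathcal{P})$ is a finitely generated group $G$ together with a finite collection $\mathcal{P}$ of infinite subgroups of $G$. $G$ carries a fixed word metric $\mathrm{dist}_G$ with respect to a finite generating set; $\mathrm{dist}_G(A,B)$ is the infimum distance between subsets and $\mathcal{N}_r(A)$ the closed $r$-neighborhood of $A$. $G/\mathcal{P}$ is the set of all left cosets $gP$, $g\in G$, $P\in\mathcal{P}$. The coset intersection complex $\mathcal{K}(G,\mathcal{P})$ is the simplicial complex with vertex set $G/\mathcal{P}$ in which a finite set $\{g_1P_1,\dots,g_kP_k\}\subset G/\mathcal{P}$ spans a simplex if and only if $\bigcap_{i=1}^k g_iP_ig_i^{-1}$ is infinite. $G$ acts on it by left multiplication on $G/\mathcal{P}$; $G$-cocompact means finitely many $G$-orbits of cells. Cliques refer to cliques of the $1$-skeleton; a subgraph as in (6) is $G$-invariant. Finite height: there is a finite bound on the $m$ for which there exist $m$ distinct cosets $g_1P_1,\dots,g_mP_m\in G/\mathcal{P}$ with $\bigcap_{i=1}^m g_iP_ig_i^{-1}$ infinite. Finite width: there is a finite bound on the $m$ for which there exist $m$ distinct cosets $g_1P_1,\dots,g_mP_m\in G/\mathcal{P}$ with $g_iP_ig_i^{-1}\cap g_jP_jg_j^{-1}$ infinite for all $i<j$. Fenced infinite intersections: there is $\tau\ge0$ such that $\mathrm{dist}_G(g_1P_1,g_2P_2)\le\tau$ whenever $g_1P_1,g_2P_2\in G/\mathcal{P}$ and $g_1P_1g_1^{-1}\cap g_2P_2g_2^{-1}$ is infinite. Commensurated core: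 a collection of subgroups representing the conjugacy classes of setwise $G$-stabilizers of maximal simplices of $\mathcal{K}(G,\mathcal{P})$. Here a maximal simplex is a maximal subset $\mathcal{S}\subset G/\mathcal{P}$ (possibly infinite) such that every finite subset $\{g_1P_1,\dots,g_kP_k\}\subset\mathcal{S}$ has $\bigcap_i g_iP_ig_i^{-1}$ infinite. Almost malnormal: for all $P,P'\in\mathcal{P}$ and $g\in G$, either $gPg^{-1}\cap P'$ is finite, or $P=P'$ and $g\in P$. Network: a metric space $X$ is a $\tau$-network ($\tau\ge0$) with respect to a collection $\mathcal{L}$ of subsets if $X=\bigcup_{L\in\mathcal{L}}\mathcal{N}_\tau(L)$ and for all $L,L'\in\mathcal{L}$ there is a sequence $L=L_1,\dots,L_n=L'$ in $\mathcal{L}$ with $\mathcal{N}_\tau(L_i)\cap\mathcal{N}_\tau(L_{i+1})$ unbounded for all $i$; it is a network with respect to $\mathcal{L}$ if it is a $\tau$-network for some $\tau\ge0$. *)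

(* Defs.v *)
From HB Require Import structures.
From mathcomp Require Import all_boot all_order all_algebra.
From mathcomp Require Import all_classical all_reals ereal metric_structure.

Set Implicit Arguments.
Unset Strict Implicit.
Unset Printing Implicit Defensive.

Import Order.TTheory GRing.Theory Num.Theory.

Local Open Scope classical_set_scope.
Local Open Scope card_scope.
Local Open Scope group_scope.

Section Groups.
Variable G : groupType.
Implicit Types (g x : G) (A P S : set G) (w : seq G).

Definition is_subgroup A : Prop := group_closed (mem A).

Definition generated_by S : Prop := smallest is_subgroup S = [set: G].

Definition finitely_generated : Prop :=
  exists S, finite_set S /\ generated_by S.

Definition ltrans g A : set G := [set g * x | x in A].

(* [ltrans g P] is the coset gP, and [gconj g P] is g P g^-1; mathcomp's [x ^ y]
   is the opposite conjugation y^-1 x y. *)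
Definition gconj g P : set G := [set g * x * g^-1 | x in P].

Record finite_generating_set := FiniteGeneratingSet {
  gens :> set G;
  gens_finite : finite_set gens;
  gens_generate : generated_by gens }.

Definition is_word S w x : Prop :=
  (forall a, a \in w -> S a \/ S a^-1) /\ \prod_(a <- w) a = x.

Lemma is_word_cat S w1 w2 x y :
  is_word S w1 x -> is_word S w2 y -> is_word S (w1 ++ w2) (x * y).
Proof.
move=> [h1 <-] [h2 <-]; split; last by rewrite big_cat.
by move=> a; rewrite mem_cat => /orP[/h1|/h2].
Qed.

Lemma is_word_inv S w x : is_word S w x -> is_word S (rev [seq a^-1 | a <- w]) x^-1.
Proof.
move=> [h <-]; split=> [a|].
  by rewrite mem_rev => /mapP[b /h hb ->]; rewrite invgK; tauto.
elim: w {h} => [|b w ih]; first by rewrite big_nil invg1.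
by rewrite /= rev_cons -cats1 big_cat big_seq1 /= ih big_cons invgM.
Qed.

Lemma word_exists (S : finite_generating_set) x :
  exists n, `[< exists2 w, is_word S w x & size w = n >].
Proof.
suff [w hw] : exists w, is_word S w x by exists (size w); apply/asboolP; exists w.
have : [set: G] x by [].
rewrite -(gens_generate S) => /(_ [set y | exists w, is_word S w y]); apply; split.
- split; first by rewrite inE; exists [::]; split => //; rewrite big_nil.
  move=> y z; rewrite !inE => -[w1 h1] [w2 h2].
  by exists (w1 ++ rev [seq a^-1 | a <- w2]); exact/is_word_cat/is_word_inv.
- move=> a Sa; exists [:: a]; split; last by rewrite big_seq1.
  by move=> b; rewrite inE => /eqP ->; left.
Qed.

Definition word_length (S : finite_generating_set) x : nat :=
  ex_minn (word_exists S x).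

Lemma word_lengthP (S : finite_generating_set) x :
  exists2 w, is_word S w x & size w = word_length S x.
Proof. by rewrite /word_length; case: ex_minnP => n /asboolP. Qed.

Lemma word_length_le (S : finite_generating_set) w x :
  is_word S w x -> word_length S x <= size w.
Proof.
move=> h; rewrite /word_length; case: ex_minnP => n _; apply.
by apply/asboolP; exists w.
Qed.

Lemma word_length1 (S : finite_generating_set) : word_length S 1 = 0.
Proof.
apply/eqP; rewrite -leqn0; apply: (@word_length_le S [::]).
by split => //; rewrite big_nil.
Qed.

Lemma word_length_eq0 (S : finite_generating_set) x :
  word_length S x = 0 -> x = 1.
Proof.
have [w [_ <-] <-] := word_lengthP S x.
by move/size0nil ->; rewrite big_nil.
Qed.

Lemma word_lengthV (S : finite_generating_set) x :
  word_length S x^-1 = word_length S x.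
Proof.
have leV y : word_length S y^-1 <= word_length S y.
  have [w hw <-] := word_lengthP S y.
  by have := word_length_le (is_word_inv hw); rewrite size_rev size_map.
by apply/eqP; rewrite eqn_leq leV -{1}[x]invgK leV.
Qed.

Lemma word_lengthM (S : finite_generating_set) x y :
  word_length S (x * y) <= word_length S x + word_length S y.
Proof.
have [w1 h1 <-] := word_lengthP S x; have [w2 h2 <-] := word_lengthP S y.
by rewrite -size_cat; exact/word_length_le/is_word_cat.
Qed.

End Groups.

(* The underlying type of G, with the left-invariant word metric of S. *)
Definition word_space (R : realType) (G : groupType)
  (S : finite_generating_set G) : Type := G.

Section WordMetric.
Variables (R : realType) (G : groupType) (S : finite_generating_set G).

Definition word_dist (x y : word_space R S) : R :=
  (word_length S ((x : G)^-1 * (y : G)))%:R%R.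

Lemma word_distxx x : word_dist x x = 0%R.
Proof. by rewrite /word_dist mulVg word_length1. Qed.

Lemma word_dist_eq0 x y : word_dist x y = 0%R -> x = y.
Proof.
move=> /eqP; rewrite /word_dist pnatr_eq0 => /eqP/word_length_eq0 h.
by apply: (@mulgI G (x : G)^-1); rewrite h mulVg.
Qed.

Lemma word_dist_sym x y : word_dist x y = word_dist y x.
Proof. by rewrite /word_dist -word_lengthV invgM invgK. Qed.

Lemma word_dist_triangle y x z :
  (word_dist x z <= word_dist x y + word_dist y z)%R.
Proof.
rewrite /word_dist -natrD ler_nat.
have -> : (x : G)^-1 * (z : G) = ((x : G)^-1 * (y : G)) * ((y : G)^-1 * (z : G)).
  by rewrite mulgA mulgK.
exact: word_lengthM.
Qed.

HB.instance Definition _ := Choice.copy (word_space R S) G.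
HB.instance Definition _ := isMetric.Build R (word_space R S)
  word_distxx word_dist_eq0 word_dist_sym word_dist_triangle.

End WordMetric.

Section MetricSpaces.
Variables (R : realType) (X : metricType R).
Implicit Types (A B : set X) (L : set (set X)).

(* Extended-real valued, so that the infimum over the empty set is [+oo]. *)
Definition set_dist A B : \bar R :=
  ereal_inf [set (mdist p.1 p.2)%:E | p in A `*` B].

Definition closed_nbhd (r : R) A : set X :=
  [set x | (set_dist [set x] A <= r%:E)%E].

Definition metric_bounded A : Prop :=
  exists M : R, forall x y, A x -> A y -> (mdist x y <= M)%R.

Definition tau_network (tau : R) L : Prop :=
  [/\ (0 <= tau)%R,
      [set: X] = \bigcup_(A in L) closed_nbhd tau A &
      forall A B, L A -> L B -> exists (n : nat) (c : nat -> set X),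
        [/\ c 0 = A, c n = B,
            forall i, i <= n -> L (c i) &
            forall i, i < n ->
              ~ metric_bounded (closed_nbhd tau (c i) `&`
                                closed_nbhd tau (c i.+1))]].

Definition network L : Prop := exists tau : R, tau_network tau L.

End MetricSpaces.

Record scomplex (V : Type) := SComplex {
  vertices : set V;
  simplices : set (set V);
  simplex_vertices : forall s, simplices s -> s `<=` vertices;
  simplex_finite : forall s, simplices s -> finite_set s;
  simplex_nonempty : forall s, simplices s -> s !=set0;
  vertex_simplex : forall v, vertices v -> simplices [set v];
  simplex_face : forall s t,
    simplices s -> t `<=` s -> t !=set0 -> simplices t }.

Section Complexes.
Variable V : Type.
Implicit Types (K L : scomplex V) (v w : V) (s C : set V).

Definition skeleton_simplices (n : nat) K : set (set V) :=
  [set s | simplices K s /\ s #<= `I_n.+1].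

Lemma skeleton_vertices n K s :
  skeleton_simplices n K s -> s `<=` vertices K.
Proof. by move=> [/simplex_vertices]. Qed.

Lemma skeleton_finite n K s : skeleton_simplices n K s -> finite_set s.
Proof. by move=> [/simplex_finite]. Qed.

Lemma skeleton_nonempty n K s : skeleton_simplices n K s -> s !=set0.
Proof. by move=> [/simplex_nonempty]. Qed.

Lemma skeleton_vertex n K v :
  vertices K v -> skeleton_simplices n K [set v].
Proof.
move=> Kv; split; first exact: vertex_simplex.
apply/pcard_leP/injfunPex; exists (fun=> 0%N) => //.
by move=> x y; rewrite !inE => -> ->.
Qed.

Lemma skeleton_face n K s t :
  skeleton_simplices n K s -> t `<=` s -> t !=set0 -> skeleton_simplices n K t.
Proof.
move=> [Ks sn] ts t0; split; first exact: simplex_face ts t0.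
exact: card_le_trans (subset_card_le ts) sn.
Qed.

Definition skeleton (n : nat) K : scomplex V :=
  @SComplex V (vertices K) (skeleton_simplices n K)
    (@skeleton_vertices n K) (@skeleton_finite n K) (@skeleton_nonempty n K)
    (@skeleton_vertex n K) (@skeleton_face n K).

Definition dim_le (n : nat) K : Prop :=
  forall s, simplices K s -> s #<= `I_n.+1.

Definition finite_dimensional K : Prop := exists n, dim_le n K.

(* The empty complex, which is the coset intersection complex of an empty
   collection, counts as zero dimensional. *)
Definition zero_dimensional K : Prop := dim_le 0 K.

Definition edge K v w : Prop := v <> w /\ simplices K [set v; w].

Definition clique K C : Prop :=
  C `<=` vertices K /\ forall v w, C v -> C w -> v <> w -> edge K v w.

Definition bounded_cliques K : Prop :=
  exists n, forall C, clique (skeleton 1 K) C -> C #<= `I_n.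

Definition subcomplex L K : Prop :=
  vertices L `<=` vertices K /\ simplices L `<=` simplices K.

Definition edge_connected K : Prop :=
  forall v w, vertices K v -> vertices K w ->
    exists (n : nat) (p : nat -> V),
      [/\ p 0 = v, p n = w & forall i, i < n -> edge K (p i) (p i.+1)].

(* Possibly infinite simplices: sets of vertices all of whose nonempty finite
   subsets span a simplex. *)
Definition infsimplex K s : Prop :=
  s `<=` vertices K /\
  forall t, t `<=` s -> finite_set t -> t !=set0 -> simplices K t.

Definition maximal_simplex K s : Prop :=
  infsimplex K s /\ forall t, infsimplex K t -> s `<=` t -> t = s.

End Complexes.

Section Actions.
Variables (G : groupType) (V : Type) (act : G -> V -> V).
Implicit Types (K : scomplex V) (s : set V).

Definition simplex_orbit s : set (set V) := [set act g @` s | g in [set: G]].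

Definition cocompact K : Prop :=
  finite_set [set simplex_orbit s | s in simplices K].

Definition act_invariant K : Prop :=
  forall g s, simplices K s -> simplices K (act g @` s).

Definition setwise_stab s : set G := [set g | act g @` s = s].

End Actions.

Section CosetIntersection.
Variable G : groupType.
Implicit Types (g h : G) (P Q : set G) (calP : set (set G)).

Definition group_pair calP : Prop :=
  [/\ finitely_generated G, finite_set calP &
      forall P, calP P -> is_subgroup P /\ infinite_set P].

Definition cosets calP : set (set G) :=
  [set A | exists g P, calP P /\ A = ltrans g P].

(* The intersection of the g P g^-1 over the cosets gP in s. A coset may be
   written gP in several ways, which all give the same g P g^-1, see
   [gconj_coset]. *)
Definition conj_meet calP (s : set (set G)) : set G :=
  \bigcap_(gP in [set gP : G * set G | calP gP.2 /\ s (ltrans gP.1 gP.2)])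
    gconj gP.1 gP.2.

Definition coset_simplices calP : set (set (set G)) :=
  [set s | [/\ s `<=` cosets calP, finite_set s, s !=set0 &
               infinite_set (conj_meet calP s)]].

Lemma gconj_coset_sub g h P Q : is_subgroup P -> is_subgroup Q ->
  ltrans g P = ltrans h Q -> gconj g P `<=` gconj h Q.
Proof.
move=> sP sQ e _ [x Px <-].
have mem y : P y -> exists2 q, Q q & h * q = g * y.
  move=> Py; have : ltrans g P (g * y) by exists y.
  by rewrite e => -[q Qq ?]; exists q.
have P1 : P 1 by have := sP.1; rewrite inE.
have [q Qq hq] := mem x Px; have [r Qr] := mem 1 P1; rewrite mulg1 => hr.
exists (q / r); last by rewrite mulgA hq -mulgA -invgM hr.
by rewrite -[Q _]/(_ : Prop) -inE; apply: sQ.2; rewrite inE.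
Qed.

Lemma gconj_coset g h P Q : is_subgroup P -> is_subgroup Q ->
  ltrans g P = ltrans h Q -> gconj g P = gconj h Q.
Proof.
by move=> sP sQ e; apply/seteqP; split; apply: gconj_coset_sub.
Qed.

Lemma coset_simplex_vertices calP s :
  coset_simplices calP s -> s `<=` cosets calP.
Proof. by case. Qed.

Lemma coset_simplex_finite calP s : coset_simplices calP s -> finite_set s.
Proof. by case. Qed.

Lemma coset_simplex_nonempty calP s : coset_simplices calP s -> s !=set0.
Proof. by case. Qed.

Lemma coset_vertex_simplex calP : group_pair calP ->
  forall A, cosets calP A -> coset_simplices calP [set A].
Proof.
move=> [_ _ hP] A [g [P [PP ->]]]; split.
- by move=> _ ->; exists g, P.
- exact: finite_set1.
- by exists (ltrans g P).
- have [sP iP] := hP P PP.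
  suff sub : gconj g P `<=` conj_meet calP [set ltrans g P].
    move=> /(sub_finite_set sub); apply: contra_not iP => fin.
    suff -> : P = (fun x => g^-1 * x * g) @` gconj g P by apply: finite_image.
    apply/seteqP; split=> [x Px|_ [_ [x Px <-] <-]].
      by exists (g * x * g^-1); [exists x|rewrite !mulgA mulVg mul1g mulgVK].
    by rewrite !mulgA mulVg mul1g mulgVK.
  move=> x gPx [h Q] /= [QP e].
  by rewrite (gconj_coset (hP Q QP).1 sP e).
Qed.

Lemma coset_simplex_face calP s t : coset_simplices calP s ->
  t `<=` s -> t !=set0 -> coset_simplices calP t.
Proof.
move=> [sV sf _ si] ts t0; split => //.
- exact: subset_trans sV.
- exact: sub_finite_set sf.
- apply: contra_not si; apply: sub_finite_set => x sx gP [PP tg].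
  by apply: sx; split => //; exact: ts.
Qed.

Definition coset_complex calP (hP : group_pair calP) : scomplex (set G) :=
  @SComplex (set G) (cosets calP) (coset_simplices calP)
    (@coset_simplex_vertices calP) (@coset_simplex_finite calP)
    (@coset_simplex_nonempty calP) (@coset_vertex_simplex calP hP)
    (@coset_simplex_face calP).

Definition finite_height calP : Prop :=
  exists n, forall (m : nat) (g : 'I_m -> G) (P : 'I_m -> set G),
    (forall i, calP (P i)) ->
    injective (fun i => ltrans (g i) (P i)) ->
    infinite_set (\bigcap_i gconj (g i) (P i)) -> m <= n.

Definition finite_width calP : Prop :=
  exists n, forall (m : nat) (g : 'I_m -> G) (P : 'I_m -> set G),
    (forall i, calP (P i)) ->
    injective (fun i => ltrans (g i) (P i)) ->
    (forall i j : 'I_m, i < j ->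
       infinite_set (gconj (g i) (P i) `&` gconj (g j) (P j))) -> m <= n.

Definition fenced_infinite_intersections (R : realType)
    (S : finite_generating_set G) calP : Prop :=
  exists2 tau : R, (0 <= tau)%R & forall g1 g2 P1 P2,
    calP P1 -> calP P2 ->
    infinite_set (gconj g1 P1 `&` gconj g2 P2) ->
    (@set_dist R (word_space R S) (ltrans g1 P1) (ltrans g2 P2) <= tau%:E)%E.

Definition commensurated_core calP (hP : group_pair calP)
    (C : set (set G)) : Prop :=
  let maximal := maximal_simplex (coset_complex hP) in
  let stab := setwise_stab (@ltrans G) in
  (forall Q, C Q -> exists2 s, maximal s & Q = stab s) /\
  (forall s, maximal s ->
     exists! Q, C Q /\ exists g, Q = gconj g (stab s)).

Definition almost_malnormal calP : Prop :=
  forall P P' g, calP P -> calP P' ->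
    finite_set (gconj g P `&` P') \/ (P = P' /\ P g).

End CosetIntersection.

(* Main.v *)
(* Left translation identifies g P g^-1 with the stabilizer of the coset gP, so a
   finite set of cosets spans a simplex iff its pointwise stabilizer is infinite;
   (1), (2) and (5) are read off from this.

   For (3) and (6), two cosets at word distance at most n have a common translate
   P, xP' with x in the finite ball of radius n. Hence an invariant graph of
   cosets is cocompact iff the distance between adjacent cosets is bounded. If
   the n-neighborhoods of A and B have an unbounded intersection, infinitely many
   of its points x have the form x = a u^-1 = b v^-1 with the same u, v in the
   ball, and their quotients lie in both stabilizers.

   For (4), the point is that in finite dimension a maximal simplex is determined
   by its setwise stabilizer Q: if s and t both have stabilizer Q, then Q acts on
   the finite set s `|` t, so the pointwise stabilizer of s `|` t has finite index
   in Q, and maximality gives s = t. *)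

From mathcomp Require Import finmap ereal.
Require Import Defs.
From mathcomp Require Import all_boot all_order all_algebra.
From mathcomp Require Import all_classical all_reals metric_structure.

Set Implicit Arguments.
Unset Strict Implicit.
Unset Printing Implicit Defensive.

Import Order.TTheory GRing.Theory Num.Theory.

Local Open Scope classical_set_scope.

(** * Finite sets, cardinality bounds and the pigeonhole principle *)

Section FiniteSets.
Local Open Scope card_scope.

(** Converts a cardinality bound into the form used by [finite_height] and [finite_width], which
    speak of injective families indexed by ['I_m]. For the converse, a set not of size at most n
    receives an injection from [I_n.+1]. *)
Lemma card_le_ordP (T : pointedType) (s : set T) n :
  s #<= `I_n <-> forall m (f : 'I_m -> T),
    injective f -> (forall i, s (f i)) -> m <= n.
Proof.
split=> [sn m f inj_f sf|h].
  rewrite -card_le_II; apply: card_le_trans sn.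
  rewrite (card_le_eql card_II); apply/pcard_leP/injfunPex; exists f => //.
  by move=> i j _ _; exact: inj_f.
apply: contrapT => nsn.
have : `I_n.+1 #<= s.
  have [/finite_setP[k sk]|/infiniteP] := pselect (finite_set s).
    move: nsn; rewrite (card_le_eql sk) (card_le_eqr sk) !card_le_II.
    by move=> /negP; rewrite -ltnNge.
  exact/card_le_trans/card_leT.
rewrite (card_le_eql card_II) => /pcard_leP/injfunPex[f sf inj_f].
suff : n.+1 <= n by rewrite ltnn.
by apply: (h _ f) => [i j e|i]; [apply: inj_f; rewrite ?in_setE|exact: sf].
Qed.

Lemma finite_subsets (T : choiceType) (D : set T) :
  finite_set D -> finite_set [set A | A `<=` D].
Proof.
move=> /finite_fsetP[X ->].
apply: (@sub_finite_set _ _ ((fun Y : {fset T} => [set` Y]) @` [set` fpowerset X])).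
  move=> A AX; have fA := sub_finite_set AX (finite_fset X).
  exists (fset_set A); last exact: fset_setK.
  rewrite /= fpowersetE; apply/fsubsetP => x; rewrite in_fset_set// inE.
  exact: AX.
exact/finite_image/finite_fset.
Qed.

(** Pigeonhole: otherwise Q would be a finite union of finite fibers. *)
Lemma infinite_fiber (T U : Type) (Q : set T) (f : T -> U) :
  infinite_set Q -> finite_set (f @` Q) ->
  exists y, infinite_set (Q `&` f @^-1` [set y]).
Proof.
move=> iQ fin; apply: contrapT => /forallNP h; apply: iQ.
apply: (@sub_finite_set _ _ (\bigcup_(y in f @` Q) (Q `&` f @^-1` [set y]))).
  by move=> x Qx; exists (f x); [exists x|].
by apply: bigcup_finite => // y _; apply: contrapT; apply: h.
Qed.

(** Choose a bound for each element; by monotonicity the maximum of these bounds serves all of F. *)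
Lemma finite_bound (T : Type) (F : set T) (P : T -> nat -> Prop) :
  finite_set F -> (forall x m n, m <= n -> P x m -> P x n) ->
  (forall x, F x -> exists n, P x n) ->
  exists n, forall x, F x -> P x n.
Proof.
move=> fF mono h.
have [x|f hf] := @choice _ _ (fun x n => F x -> P x n).
  have [/h[n]|nFx] := pselect (F x); first by exists n.
  by exists 0.
have /finite_fsetP[X FX] := finite_image f fF.
exists (\max_(i <- X) i) => x Fx; apply: (mono _ (f x)); last exact: hf.
apply: leq_bigmax_seq => //.
by have : [set f x | x in F] (f x) by [exists x]; rewrite FX.
Qed.

Lemma card_le2P (T : pointedType) (s : set T) :
  s #<= `I_2 -> s !=set0 -> exists A B, s = [set A; B].
Proof.
move=> /card_le_ordP s2 [A sA].
have [sub|] := pselect (s `<=` [set A]).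
  by exists A, A; rewrite setUid; apply/seteqP; split=> // _ ->.
move=> /existsNP[B /not_implyP[sB AB]]; exists A, B; apply/seteqP; split.
  move=> C sC; apply: contrapT => /not_orP[CA CB].
  suff : 3 <= 2 by [].
  apply: (s2 _ (fun i : 'I_3 => nth A [:: A; B; C] i)).
    move=> [[|[|[|//]]] ?] [[|[|[|//]]] ?] /= e; apply: val_inj => //=;
      by [case: AB|case: CA|case: CB].
  by move=> [[|[|[|//]]] ?] /=.
by move=> _ [->|->].
Qed.

Lemma card_set2_le (T : pointedType) (A B : T) : [set A; B] #<= `I_2.
Proof.
apply: (card_le_trans _ (card_image_le (nth A [:: A; B]) `I_2)).
by apply: subset_card_le => _ [->|->]; [exists 0|exists 1].
Qed.

End FiniteSets.

(** * Left translates, conjugates and stabilizers *)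

Section Translates.
Local Open Scope group_scope.
Variable G : groupType.
Implicit Types (g h x y : G) (A B P Q : set G) (s t : set (set G)).

Lemma subgroup1 P : is_subgroup P -> P 1.
Proof. by case; rewrite inE. Qed.

Lemma subgroupV P x : is_subgroup P -> P x -> P x^-1.
Proof.
move=> /group_closedV h Px; rewrite -[P _]/(_ : Prop) -inE; apply: h.
by rewrite inE.
Qed.

Lemma subgroupM P x y : is_subgroup P -> P x -> P y -> P (x * y).
Proof.
move=> /group_closedM h Px Py; rewrite -[P _]/(_ : Prop) -inE.
by apply: h; rewrite inE.
Qed.

Lemma ltransE g A x : ltrans g A x <-> A (g^-1 * x).
Proof.
split=> [[a Aa <-]|Ax]; first by rewrite mulgA mulVg mul1g.
by exists (g^-1 * x) => //; rewrite mulgA mulgV mul1g.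
Qed.

Lemma gconjE g A x : gconj g A x <-> A (g^-1 * x * g).
Proof.
split=> [[a Aa <-]|Ax]; first by rewrite !mulgA mulVg mul1g mulgVK.
by exists (g^-1 * x * g) => //; rewrite !mulgA mulgV mul1g mulgK.
Qed.

Lemma ltrans1 A : ltrans 1 A = A.
Proof. by apply/seteqP; split=> x; rewrite ltransE invg1 mul1g. Qed.

Lemma ltransM g h A : ltrans (g * h) A = ltrans g (ltrans h A).
Proof. by apply/seteqP; split=> x; rewrite !ltransE invgM mulgA. Qed.

Lemma ltransK g : cancel (ltrans g) (ltrans g^-1).
Proof. by move=> A; rewrite -ltransM mulVg ltrans1. Qed.

Lemma ltrans_inj g : injective (ltrans g).
Proof. exact: can_inj (ltransK g). Qed.

Lemma ltrans_setM g h s : ltrans (g * h) @` s = ltrans g @` (ltrans h @` s).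
Proof. by rewrite image_comp; apply: eq_imagel => A _ /=; rewrite ltransM. Qed.

Lemma ltrans_set1 s : ltrans 1 @` s = s.
Proof. by apply/seteqP; split=> [_ [A sA <-]|A sA]; [|exists A]; rewrite ?ltrans1. Qed.

Lemma ltrans_setK g s : ltrans g^-1 @` (ltrans g @` s) = s.
Proof. by rewrite -ltrans_setM mulVg ltrans_set1. Qed.

Lemma ltrans_setVK g s : ltrans g @` (ltrans g^-1 @` s) = s.
Proof. by rewrite -ltrans_setM mulgV ltrans_set1. Qed.

Lemma gconjK g : cancel (@gconj G g) (gconj g^-1).
Proof.
move=> A; apply/seteqP; split=> x; rewrite !gconjE invgK !mulgA mulVg mul1g mulgVK //.
Qed.

Lemma gconj1 A : gconj 1 A = A.
Proof. by apply/seteqP; split=> x; rewrite gconjE invg1 mul1g mulg1. Qed.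

Lemma gconjM g h A : gconj (g * h) A = gconj g (gconj h A).
Proof. by apply/seteqP; split=> x; rewrite !gconjE invgM !mulgA. Qed.

Lemma infinite_gconj g A : infinite_set A -> infinite_set (gconj g A).
Proof. by apply: contra_not => fin; rewrite -(gconjK g A); apply: finite_image. Qed.

Lemma setwise_stab_ltrans g s :
  setwise_stab (@ltrans G) (ltrans g @` s) = gconj g (setwise_stab (@ltrans G) s).
Proof.
apply/seteqP; split=> x; rewrite gconjE /setwise_stab /= => e.
  by rewrite -mulgA !ltrans_setM e ltrans_setK.
by rewrite -{2}e -!ltrans_setM !mulgA mulgV mul1g.
Qed.

(** For a coset gP this is the conjugate of P by g, expressed without choosing a representative
    g. *)
Definition lstab A : set G := [set g | ltrans g A = A].

Lemma lstab_mem A x a : lstab A x -> A a -> A (x * a).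
Proof. by rewrite /lstab /= => e Aa; rewrite -e; exists a. Qed.

Lemma lstab_ltrans g A : lstab (ltrans g A) = gconj g (lstab A).
Proof.
apply/seteqP; split=> x; rewrite gconjE /lstab /= => e.
  by rewrite -mulgA !ltransM e ltransK.
by rewrite -{2}e -!ltransM !mulgA mulgV mul1g.
Qed.

Lemma lstab_subgroup P : is_subgroup P -> lstab P = P.
Proof.
move=> sP; apply/seteqP; split=> x.
  by rewrite /lstab /= => <-; exists 1; [exact: subgroup1|rewrite mulg1].
move=> Px; apply/seteqP; split=> y; rewrite ltransE => Py.
  by rewrite -(mulKg x^-1 y) invgK; exact: subgroupM.
by apply: subgroupM => //; exact: subgroupV.
Qed.

Lemma lstab_coset g P : is_subgroup P -> lstab (ltrans g P) = gconj g P.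
Proof. by move=> sP; rewrite lstab_ltrans lstab_subgroup. Qed.

Lemma coset_eqP g h P : is_subgroup P -> P (h^-1 * g) -> ltrans g P = ltrans h P.
Proof.
move=> sP hg; apply: (@ltrans_inj h^-1); rewrite -!ltransM mulVg ltrans1.
by move: hg; rewrite -{1}(lstab_subgroup sP).
Qed.

Definition pstab s : set G := [set x | forall A, s A -> lstab A x].

Lemma pstab_ltrans g s : pstab (ltrans g @` s) = gconj g (pstab s).
Proof.
apply/seteqP; split=> x; rewrite gconjE => hx A.
  move=> sA; have := hx (ltrans g A) (imageP _ sA).
  by rewrite lstab_ltrans gconjE.
by move=> [B sB <-]; rewrite lstab_ltrans gconjE; apply: hx.
Qed.

Lemma pstab_sub s t : s `<=` t -> pstab t `<=` pstab s.
Proof. by move=> st x h A /st; apply: h. Qed.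

Lemma pstab2 A B : pstab [set A; B] = lstab A `&` lstab B.
Proof.
apply/seteqP; split=> [x h|x [hA hB] _ [->|->] //].
by split; apply: h; [left|right].
Qed.

(* Q acts on the finite set t, and the kernel of a homomorphism from an infinite
   group to a finite one is infinite. *)
Lemma infinite_pstab (Q : set G) t : infinite_set Q -> finite_set t ->
  (forall x A, Q x -> t A -> t (ltrans x A)) -> infinite_set (pstab t).
Proof.
move=> iQ ft Qt.
(* The action of x on t is recorded by its graph, a subset of the finite set t x t. If x and x0 have
   the same graph, then [x0^-1 * x] fixes t pointwise. *)
pose graph x := [set (A, ltrans x A) | A in t].
have [|f] := @infinite_fiber _ _ Q graph iQ.
  apply: (sub_finite_set _ (finite_subsets (finite_setX ft ft))).
  move=> _ [x Qx <-] _ [A tA <-]; split => //; exact: Qt.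
move=> ifib; have [x0 [Qx0 fx0]] := infinite_setN0 ifib.
apply: contra_not ifib => fin.
apply: (sub_finite_set _ (finite_image (fun y => x0 * y) fin)).
move=> x [Qx fx]; exists (x0^-1 * x); last by rewrite mulgA mulgV mul1g.
move=> A tA; have : graph x (A, ltrans x A) by exists A.
rewrite (fx : graph x = f) -(fx0 : graph x0 = f) => -[_ _ [-> e]].
by rewrite /lstab /= ltransM -e ltransK.
Qed.

End Translates.

(** * Simplices as sets of cosets with infinite pointwise stabilizer *)

Section Cosets.
Local Open Scope group_scope.
Variables (G : groupType) (calP : set (set G)) (hP : group_pair calP).
Implicit Types (g h x y : G) (A B P Q : set G) (s t : set (set G)).

Let sub P : calP P -> is_subgroup P.
Proof. by case: hP => _ _ h /h[]. Qed.

Lemma coset_inhabited A : cosets calP A -> A !=set0.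
Proof. by move=> [g [P [/sub/subgroup1 P1 ->]]]; exists (g * 1); exists 1. Qed.

Lemma cosets_ltrans g A : cosets calP A -> cosets calP (ltrans g A).
Proof. by move=> [h [P [PP ->]]]; exists (g * h), P; rewrite ltransM. Qed.

Lemma coset_mem A x : cosets calP A -> A x ->
  exists2 P, calP P & A = ltrans x P.
Proof.
move=> [g [P [PP ->]]] /ltransE Pgx; exists P => //.
apply/esym/coset_eqP => //; exact: sub.
Qed.

(** Writing A = yP, the element [y^-1 * x] lies in P, and conjugating it by y gives [x * y^-1]. *)
Lemma coset_lstab A x y : cosets calP A -> A x -> A y -> lstab A (x * y^-1).
Proof.
move=> cA Ax Ay; have [P PP AE] := coset_mem cA Ay.
rewrite AE lstab_coset; last exact: sub.
by apply/gconjE; move: Ax; rewrite AE ltransE !mulgA mulgVK.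
Qed.

Lemma conj_meetE s : s `<=` cosets calP -> conj_meet calP s = pstab s.
Proof.
move=> sc; apply/seteqP; split=> x hx.
  move=> A /[dup] /sc[g [P [PP ->]]] sA; rewrite lstab_coset; last exact: sub.
  exact: (hx (g, P)).
by move=> [g P] /= [PP /hx]; rewrite lstab_coset//; exact: sub.
Qed.

Lemma coset_simplicesP s : coset_simplices calP s <->
  [/\ s `<=` cosets calP, finite_set s, s !=set0 & infinite_set (pstab s)].
Proof.
by split=> -[sc sf s0 si]; split=> //; move: si; rewrite conj_meetE.
Qed.

Lemma coset_simplices_ltrans g s :
  coset_simplices calP s -> coset_simplices calP (ltrans g @` s).
Proof.
move=> /coset_simplicesP[sc sf [A sA] si]; apply/coset_simplicesP; split.
- by move=> _ [B /sc cB <-]; exact: cosets_ltrans.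
- exact: finite_image.
- by exists (ltrans g A); exists A.
- by rewrite pstab_ltrans; exact: infinite_gconj.
Qed.

Lemma coset_simplices2 A B : cosets calP A -> cosets calP B ->
  infinite_set (lstab A `&` lstab B) -> coset_simplices calP [set A; B].
Proof.
move=> cA cB iAB; apply/coset_simplicesP; split; rewrite ?pstab2//.
- by move=> _ [->|->].
- by exists A; left.
Qed.

Lemma coset_simplex_lstab s A B : coset_simplices calP s -> s A -> s B ->
  infinite_set (lstab A `&` lstab B).
Proof.
move=> /coset_simplicesP[_ _ _ si] sA sB; rewrite -pstab2.
by apply: sub_infinite_set si; apply: pstab_sub => _ [->|->].
Qed.

End Cosets.

(** * Finite height, finite width and almost malnormality *)

Section Dimension.
Local Open Scope group_scope.
Local Open Scope card_scope.
Variables (G : groupType) (calP : set (set G)) (hP : group_pair calP).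
Implicit Types (g h x y : G) (A B P Q : set G) (s t : set (set G)).
Let K := coset_complex hP.

Let sub P : calP P -> is_subgroup P.
Proof. by case: hP => _ _ h /h[]. Qed.

(** Turns a family of vertices into the pairs (g, P) over which height and width quantify. *)
Lemma coset_reps (I : Type) (f : I -> set G) : (forall i, cosets calP (f i)) ->
  exists (g : I -> G) (P : I -> set G),
    (forall i, calP (P i)) /\ f = (fun i => ltrans (g i) (P i)).
Proof.
move=> cf; have [|r hr] := @choice _ _ (fun i (r : G * set G) =>
    calP r.2 /\ f i = ltrans r.1 r.2).
  by move=> i; have [g [P [PP e]]] := cf i; exists (g, P).
exists (fun i => (r i).1), (fun i => (r i).2); split=> [i|].
  by case: (hr i).
by apply/funext => i; case: (hr i).
Qed.

Lemma pstab_range (I : Type) (g : I -> G) (P : I -> set G) :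
  (forall i, calP (P i)) ->
  pstab (range (fun i => ltrans (g i) (P i))) = \bigcap_i gconj (g i) (P i).
Proof.
move=> PP; apply/seteqP; split=> x hx.
  by move=> i _; rewrite -(lstab_coset _ (sub (PP i))); apply: hx; exists i.
by move=> _ [i _ <-]; rewrite (lstab_coset _ (sub (PP i))); exact: hx.
Qed.

Lemma finite_dimensionalP : finite_dimensional K <-> finite_height calP.
Proof.
split=> [[n hn]|[n hn]].
  (* Dimension n means at most n + 1 vertices. The empty family is split off because a simplex is
     nonempty. *)
  exists n.+1 => -[//|m] g P PP inj_f; rewrite -pstab_range// => inf.
  have /hn/card_le_ordP : simplices K (range (fun i => ltrans (g i) (P i))).
    apply/(coset_simplicesP hP); split=> //.
    - by move=> _ [i _ <-]; exists (g i), (P i).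
    - exact/finite_image/finite_finset.
    - by exists (ltrans (g ord0) (P ord0)), ord0.
  by apply; [exact: inj_f|move=> i; exists i].
exists n => s /(coset_simplicesP hP)[sc _ _ si].
apply/card_le_ordP => m f inj_f sf.
have [g [P [PP fE]]] := coset_reps (fun i => sc _ (sf i)).
(* A height bound n allows n vertices, one fewer than [dim_le n] does. *)
apply: leqW; apply: (hn m g P) => //; first by rewrite -fE.
rewrite -pstab_range// -fE; apply: sub_infinite_set si.
by apply: pstab_sub => _ [i _ <-].
Qed.

Lemma edge_skeleton1P A B : edge (skeleton 1 K) A B <->
  [/\ A <> B, cosets calP A, cosets calP B & infinite_set (lstab A `&` lstab B)].
Proof.
split=> [[AB [sAB _]]|[AB cA cB iAB]].
  split=> //; [apply: (simplex_vertices sAB); by left|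
    apply: (simplex_vertices sAB); by right|].
  by apply: (coset_simplex_lstab hP sAB); [left|right].
by split=> //; split; [exact: coset_simplices2|exact: card_set2_le].
Qed.

Lemma bounded_cliquesP : bounded_cliques K <-> finite_width calP.
Proof.
split=> -[n hn]; exists n.
  move=> m g P PP inj_f inf.
  have /hn/card_le_ordP :
      clique (skeleton 1 K) (range (fun i => ltrans (g i) (P i))).
    split=> [_ [i _ <-]|_ _ [i _ <-] [j _ <-] ij]; first by exists (g i), (P i).
    apply/edge_skeleton1P; split=> //; [by exists (g i), (P i)|by exists (g j), (P j)|].
    rewrite !lstab_coset//; try exact: sub.
    have [lij|lji|/val_inj eij] := ltngtP i j; first exact: inf.
      by rewrite setIC; exact: inf.
    by rewrite eij in ij.
  by apply; [exact: inj_f|move=> i; exists i].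
move=> C [Cc CE]; apply/card_le_ordP => m f inj_f Cf.
have [g [P [PP fE]]] := coset_reps (fun i => Cc _ (Cf i)).
have fEi i : f i = ltrans (g i) (P i) by rewrite fE.
apply: (hn m g P) => // [|i j ij]; first by rewrite -fE.
rewrite -!lstab_coset//; try exact: sub.
rewrite -!fEi; have /edge_skeleton1P[] // : edge (skeleton 1 K) (f i) (f j).
by apply: CE => // /inj_f eij; rewrite eij ltnn in ij.
Qed.

(** In dimension zero, an infinite intersection makes gP and P' the same vertex; since P' contains
    1, this gives g in P and then P = P'. Conversely, for two vertices gP and hQ of a simplex,
    malnormality is applied to [h^-1 * g]. *)
Lemma zero_dimensionalP : zero_dimensional K <-> almost_malnormal calP.
Proof.
split=> [h P P' g PP PP'|h s sK].
  have [|inf] := pselect (finite_set (gconj g P `&` P')); first by left.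
  right; have eP : ltrans g P = P'.
    have /h/card_le_ordP c1 : simplices K [set ltrans g P; P'].
      apply: (coset_simplices2 hP); first by exists g, P.
      - by exists 1, P'; rewrite ltrans1.
      - by rewrite lstab_coset ?lstab_subgroup//; exact: sub.
    apply: contrapT => ne; suff : 2 <= 1 by [].
    apply: (c1 _ (fun i : 'I_2 => if i == ord0 then ltrans g P else P')).
      move=> [[|[|//]] ?] [[|[|//]] ?] //= e; apply: val_inj => //=; by case: ne.
    by move=> i; case: ifP => _; [left|right].
  have Pg : P g.
    have : P' 1 by exact: (subgroup1 (sub PP')).
    rewrite -eP ltransE mulg1 => Pg.
    by rewrite -(invgK g); exact: (subgroupV (sub PP)).
  split=> //; rewrite -eP; apply/esym.
  by move: Pg; rewrite -{1}(lstab_subgroup (sub PP)).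
have [sc _ _ _] := sK.
apply/card_le_ordP => m f inj_f sf; rewrite leqNgt; apply/negP => m1.
suff e : f (Ordinal (ltnW m1)) = f (Ordinal m1) by move/inj_f/(congr1 val): e.
have := coset_simplex_lstab hP sK (sf (Ordinal (ltnW m1))) (sf (Ordinal m1)).
have [g [P [PP ->]]] := sc _ (sf (Ordinal (ltnW m1))).
have [h' [Q [QP ->]]] := sc _ (sf (Ordinal m1)).
rewrite !lstab_coset//; try exact: sub.
move=> inf; have [fin|[<- Phg]] := h P Q (h'^-1 * g) PP QP.
  (* Conjugation by [h'] carries the finite intersection back to that of the two vertex
     stabilizers. *)
  exfalso; move: fin; apply: contra_not inf => fin.
  apply: sub_finite_set (finite_image (fun x => h' * x * h'^-1) fin) => x [xP xQ].
  exists (h'^-1 * x * h'); last by rewrite !mulgA mulgV mul1g mulgK.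
  split; last exact/gconjE.
  by rewrite gconjM; apply/gconjE; rewrite invgK !mulgA mulgV mul1g mulgK.
by apply: coset_eqP => //; exact: sub.
Qed.

End Dimension.

(** * Cocompactness through finite sets of orbit representatives *)

Section Orbits.
Local Open Scope group_scope.
Variable G : groupType.
Implicit Types (K : scomplex (set G)) (s t : set (set G)) (F : set (set (set G))).

Lemma cocompact_reps K : cocompact (@ltrans G) K ->
  exists F, [/\ finite_set F, F `<=` simplices K &
    forall s, simplices K s -> exists g t, F t /\ s = ltrans g @` t].
Proof.
rewrite /cocompact; set O := [set _ | _ in _] => fO.
have [o|r hr] := @choice _ _ (fun o s => O o -> simplices K s /\
    simplex_orbit (@ltrans G) s = o).
  have [[s Ks <-]|nO] := pselect (O o); first by exists s.
  by exists set0.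
exists (r @` O); split; first exact: finite_image.
  by move=> _ [o /hr[Kr _] <-].
move=> s Ks; have Os : O (simplex_orbit (@ltrans G) s) by exists s.
have [_ e] := hr _ Os.
have : simplex_orbit (@ltrans G) s s by exists 1 => //; rewrite ltrans_set1.
rewrite -{1}e => -[g _ <-]; exists g, (r (simplex_orbit (@ltrans G) s)).
by split=> //; exists (simplex_orbit (@ltrans G) s).
Qed.

Lemma simplex_orbit_ltrans g s :
  simplex_orbit (@ltrans G) (ltrans g @` s) = simplex_orbit (@ltrans G) s.
Proof.
apply/seteqP; split=> [_ [h _ <-]|_ [h _ <-]].
  by exists (h * g) => //; rewrite ltrans_setM.
by exists (h * g^-1) => //; rewrite ltrans_setM ltrans_setK.
Qed.

Lemma reps_cocompact K F : finite_set F ->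
  (forall s, simplices K s -> exists g t, F t /\ s = ltrans g @` t) ->
  cocompact (@ltrans G) K.
Proof.
move=> fF hF; apply: (sub_finite_set _ (finite_image (simplex_orbit (@ltrans G)) fF)).
by move=> _ [s /hF[g [t [Ft ->]]] <-]; exists t => //; rewrite simplex_orbit_ltrans.
Qed.

End Orbits.

(** * Finite balls and distances between sets in the word metric *)

Section WordMetric.
Local Open Scope group_scope.
Variables (R : realType) (G : groupType) (S : finite_generating_set G).
Implicit Types (g x y : G) (A B : set G).
Local Notation len := (word_length S).

Lemma finite_word_ball n : finite_set [set x | len x <= n].
Proof.
(* The letters of words. Induction on the length removes the first letter, which lies in the finite
   set T. *)
pose T := gens S `|` (fun x => x^-1) @` gens S.
have fT : finite_set T.
  by rewrite finite_setU; split; [|apply: finite_image]; exact: gens_finite.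
have fin k : finite_set [set x | exists2 w, is_word S w x & size w <= k].
  elim: k => [|k ih].
    apply: (sub_finite_set _ (finite_set1 1)) => _ [w [_ <-]].
    by rewrite leqn0 => /nilP -> /=; rewrite big_nil.
  apply: (sub_finite_set _ (_ : finite_set (1 |` [set a * x | a in T & x in
     [set x | exists2 w, is_word S w x & size w <= k]]))); last first.
    by rewrite finite_setU; split; [exact: finite_set1|exact: finite_image2].
  move=> _ [[|a w] [hw <-]] /= sw; first by left; rewrite big_nil.
  right; rewrite big_cons; exists a.
    have [|Sa] := hw a (mem_head _ _); first by left.
    by right; exists a^-1 => //; rewrite invgK.
  exists (\prod_(b <- w) b) => //; exists w => //; split=> // b bw.
  by apply: hw; rewrite in_cons bw orbT.
apply: sub_finite_set (fin n) => x /= xn.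
by have [w hw sw] := word_lengthP S x; exists w => //; rewrite sw.
Qed.

(** An integral substitute for [set_dist] that supplies the two points realizing the bound. *)
Definition near_sets n A B := exists a b, [/\ A a, B b & len (a^-1 * b) <= n].

Lemma near_ltrans n g A B : near_sets n A B -> near_sets n (ltrans g A) (ltrans g B).
Proof.
move=> [a [b [Aa Bb ab]]]; exists (g * a), (g * b).
by split; [exists a|exists b|rewrite invgM -mulgA mulKg].
Qed.

Lemma near_sets_sym n A B : near_sets n A B -> near_sets n B A.
Proof.
by move=> [a [b [Aa Bb ab]]]; exists b, a; rewrite -word_lengthV invgM invgK.
Qed.

Lemma near_sets_refl n A : A !=set0 -> near_sets n A A.
Proof. by move=> [a Aa]; exists a, a; rewrite mulVg word_length1. Qed.

Lemma near_set_dist n A B : near_sets n A B ->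
  (@set_dist R (word_space R S) A B <= n%:R%:E)%E.
Proof.
move=> [a [b [Aa Bb ab]]]; apply: ge_ereal_inf.
exists (@mdist R (word_space R S) a b)%:E; first by exists (a, b).
by rewrite lee_fin ler_nat.
Qed.

(** The strict inequality puts the infimum below n, so some pair of points is at distance below
    n. *)
Lemma set_dist_near (tau : R) n A B : (tau < n%:R)%R ->
  (@set_dist R (word_space R S) A B <= tau%:E)%E -> near_sets n A B.
Proof.
move=> taun; rewrite -lte_fin in taun => /le_lt_trans/(_ taun).
move=> /ereal_inf_lt[_ [[a b] [/= Aa Bb] <-]].
by rewrite lte_fin ltr_nat => /ltnW ab; exists a, b.
Qed.

(** A bounded set lies in a translate of a word ball, and balls are finite. *)
Lemma metric_boundedP A :
  @metric_bounded R (word_space R S) A <-> finite_set A.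
Proof.
split=> [[M hM]|fA].
  have [->|/set0P[a Aa]] := eqVneq A set0; first exact: finite_set0.
  apply: (sub_finite_set _ (finite_image (fun x => a * x)
    (finite_word_ball (Num.truncn M)))) => x Ax.
  exists (a^-1 * x); last by rewrite mulgA mulgV mul1g.
  have := le_lt_trans (hM a x Aa Ax) (truncnS_gt M).
  by rewrite ltr_nat ltnS.
have [||n hn] := @finite_bound _ A (fun x n => len x <= n) fA.
  by move=> x m n mn /leq_trans; apply.
  by move=> x _; exists (len x).
(* The triangle inequality through 1. *)
exists (n + n)%:R%R => x y /hn xn /hn yn; rewrite ler_nat.
apply: leq_trans (word_lengthM _ _ _) _.
by rewrite leq_add// word_lengthV.
Qed.

End WordMetric.

(** * Cocompact graphs of cosets, fenced intersections and networks *)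

Section CocompactGraphs.
Local Open Scope group_scope.
Local Open Scope card_scope.
Variables (R : realType) (G : groupType) (S : finite_generating_set G).
Variables (calP : set (set G)) (hP : group_pair calP).
Implicit Types (g x y : G) (A B P Q : set G) (s t : set (set G)).
Implicit Types (L : scomplex (set G)).
Let K := coset_complex hP.
Local Notation len := (word_length S).
Local Notation near_sets := (near_sets S).
Local Notation nbhd tau A := (@closed_nbhd R (word_space R S) tau A).

Let sub P : calP P -> is_subgroup P.
Proof. by case: hP => _ _ h /h[]. Qed.

Lemma cocompact_graphP L : subcomplex L (skeleton 1 K) ->
  cocompact (@ltrans G) L <->
  exists n, forall s A B, simplices L s -> s A -> s B -> near_sets n A B.
Proof.
move=> [_ LK]; split=> [/cocompact_reps[F [fF FL LF]]|[n hn]].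
  pose P s n := forall A B, s A -> s B -> near_sets n A B.
  (* The bound is taken first over the pairs of vertices of one representative, then over all
     representatives; translation preserves it. *)
  have [s m n mn h A B sA sB|s Fs|n hn] := @finite_bound _ F P fF.
  - have [a [b [Aa Bb ab]]] := h A B sA sB.
    by exists a, b; split=> //; exact: leq_trans ab mn.
  - have [[sc sf _ _] _] := LK _ (FL _ Fs).
    have [p m n mn|[A B] [/= /sc cA /sc cB]|n hn] :=
      @finite_bound _ (s `*` s) (fun p n => near_sets n p.1 p.2) (finite_setX sf sf).
    + move=> [a [b [Aa Bb ab]]].
      by exists a, b; split=> //; exact: leq_trans ab mn.
    + have [a Aa] := coset_inhabited hP cA; have [b Bb] := coset_inhabited hP cB.
      by exists (len (a^-1 * b)), a, b.
    + by exists n => A B sA sB; exact: (hn (A, B)).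
  exists n => s A B /LF[g [t [Ft ->]]] [A' tA' <-] [B' tB' <-].
  by apply: near_ltrans; exact: hn Ft _ _ tA' tB'.
have [_ fP _] := hP.
(* Given nearby points a of A and b of B, translation by [a^-1] turns {A, B} into {P, xQ} with
   [x = a^-1 * b] in the ball. A single vertex is the case A = B. *)
apply: (@reps_cocompact _ _
  [set [set p.1; ltrans x p.2] | p in calP `*` calP & x in [set x | len x <= n]]).
  by apply: finite_image2; [exact: finite_setX|exact: finite_word_ball].
move=> s Ls; have [[sc sf s0 _] s2] := LK _ Ls.
have [A [B e]] := card_le2P s2 s0.
have sA : s A by rewrite e; left.
have sB : s B by rewrite e; right.
have [a [b [Aa Bb ab]]] := hn s A B Ls sA sB.
have [P PP AE] := coset_mem hP (sc _ sA) Aa.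
have [Q PQ BE] := coset_mem hP (sc _ sB) Bb.
exists a, [set P; ltrans (a^-1 * b) Q]; split.
  by exists (P, Q) => //; exists (a^-1 * b).
by rewrite e image_setU !image_set1 -ltransM mulgA mulgV mul1g AE BE.
Qed.

Lemma cocompact_skeletonP : cocompact (@ltrans G) (skeleton 1 K) <->
  fenced_infinite_intersections R S calP.
Proof.
rewrite cocompact_graphP; last by split.
split=> [[n hn]|[tau tau0 h]].
  exists n%:R%R => // g1 g2 P1 P2 PP1 PP2 inf; apply: near_set_dist.
  apply: (hn [set ltrans g1 P1; ltrans g2 P2]); [|by left|by right].
  split; last exact: card_set2_le.
  apply: (coset_simplices2 hP); [by exists g1, P1|by exists g2, P2|].
  by rewrite !lstab_coset//; exact: sub.
(* An integer strictly above [tau], as [set_dist_near] requires. *)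
exists (Num.truncn tau).+1 => s A B [sK _] sA sB.
apply: (set_dist_near (truncnS_gt tau)).
have [sc _ _ _] := sK; have := coset_simplex_lstab hP sK sA sB.
have [g1 [P1 [PP1 ->]]] := sc _ sA; have [g2 [P2 [PP2 ->]]] := sc _ sB.
by rewrite !lstab_coset; [exact: h|exact: sub|exact: sub].
Qed.

(** Each x stabilizing both cosets gives a point [x * a] of A within n of the point [x * b] of B;
    infinitely many x give infinitely many points. *)
Lemma near_unbounded n A B : cosets calP A -> cosets calP B ->
  near_sets n A B -> infinite_set (lstab A `&` lstab B) ->
  ~ @metric_bounded R (word_space R S) (nbhd n%:R A `&` nbhd n%:R B).
Proof.
move=> cA cB [a [b [Aa Bb ab]]] inf /metric_boundedP fin; apply: inf.
apply: (sub_finite_set _ (finite_image (fun x => x * a^-1) fin)).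
move=> x [xA xB]; exists (x * a); last by rewrite mulgK.
split; apply: near_set_dist; exists (x * a).
  by exists (x * a); rewrite mulVg word_length1; split=> //; exact: lstab_mem.
exists (x * b); split=> //; first exact: lstab_mem.
by rewrite invgM -mulgA mulKg.
Qed.

Lemma unbounded_near (tau : R) n A B : (tau < n%:R)%R ->
  cosets calP A -> cosets calP B ->
  ~ @metric_bounded R (word_space R S) (nbhd tau A `&` nbhd tau B) ->
  near_sets (n + n) A B /\ infinite_set (lstab A `&` lstab B).
Proof.
move=> taun cA cB; rewrite metric_boundedP; set I := _ `&` _ => iI.
(* [f x] is a pair of short displacements from x into A and into B; outside I it is an arbitrary
   pair. *)
have [x|f hf] := @choice _ _ (fun x (u : G * G) => I x ->
    [/\ A (x * u.1), B (x * u.2), len u.1 <= n & len u.2 <= n]).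
  have [[xA xB]|nI] := pselect (I x); last by exists (1, 1).
  have [_ [a [-> Aa xa]]] := set_dist_near taun xA.
  have [_ [b [-> Bb xb]]] := set_dist_near taun xB.
  by exists (x^-1 * a, x^-1 * b); rewrite /= !mulgA !mulgV !mul1g.
split.
  (* Two displacements from a common point x account for the bound n + n. *)
  have [x /hf[Ax Bx ux vx]] := infinite_setN0 iI.
  exists (x * (f x).1), (x * (f x).2); split=> //.
  rewrite invgM -mulgA mulKg; apply: leq_trans (word_lengthM _ _ _) _.
  by rewrite word_lengthV leq_add.
(* Only finitely many pairs of displacements exist, so infinitely many points share one. It cancels
   in the quotient of the corresponding points of A, leaving [x * x0^-1] in the stabilizer of A;
   likewise for B. *)
have [|u] := @infinite_fiber _ _ I f iI.
  apply: sub_finite_set (finite_setX (finite_word_ball S n) (finite_word_ball S n)).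
  by move=> _ [x /hf[_ _ ux vx] <-].
move=> ifib; have [x0 [Ix0 fx0]] := infinite_setN0 ifib.
apply: contra_not ifib => fin.
apply: (sub_finite_set _ (finite_image (fun z => z * x0) fin)).
move=> x [/hf[Ax Bx _ _] fx]; exists (x * x0^-1); last by rewrite mulgVK.
have [Ax0 Bx0 _ _] := hf _ Ix0.
move: Ax Bx Ax0 Bx0; rewrite (fx : f x = u) (fx0 : f x0 = u) => Ax Bx Ax0 Bx0.
split.
  by have := coset_lstab hP cA Ax Ax0; rewrite invgM mulgA mulgK.
by have := coset_lstab hP cB Bx Bx0; rewrite invgM mulgA mulgK.
Qed.

Section FencedGraph.
Variable n : nat.

(** The subgraph of the 1-skeleton that keeps all vertices but only edges between cosets at distance
    at most n. It witnesses the passage from a network to a cocompact graph. *)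
Definition fenced_simplices : set (set (set G)) :=
  [set s | simplices (skeleton 1 K) s /\
           forall A B, s A -> s B -> near_sets n A B].

Lemma fenced_vertices s : fenced_simplices s -> s `<=` cosets calP.
Proof. by move=> [/simplex_vertices]. Qed.

Lemma fenced_finite s : fenced_simplices s -> finite_set s.
Proof. by move=> [/simplex_finite]. Qed.

Lemma fenced_nonempty s : fenced_simplices s -> s !=set0.
Proof. by move=> [/simplex_nonempty]. Qed.

Lemma fenced_vertex A : cosets calP A -> fenced_simplices [set A].
Proof.
move=> cA; split; first exact: (vertex_simplex (s0 := skeleton 1 K)).
by move=> _ _ -> ->; exact/near_sets_refl/(coset_inhabited hP).
Qed.

Lemma fenced_face s t : fenced_simplices s -> t `<=` s -> t !=set0 ->
  fenced_simplices t.
Proof.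
move=> [sK sn] ts t0; split; first exact: simplex_face ts t0.
by move=> A B /ts sA /ts sB; exact: sn.
Qed.

Definition fenced_graph : scomplex (set G) :=
  @SComplex _ (cosets calP) fenced_simplices fenced_vertices fenced_finite
    fenced_nonempty fenced_vertex fenced_face.

End FencedGraph.

(** A chain in a network may repeat a coset, whereas an edge has distinct ends, so stationary steps
    are deleted. *)
Lemma edge_path (V : Type) (L : scomplex V) (p : nat -> V) m :
  (forall i, i < m -> p i = p i.+1 \/ edge L (p i) (p i.+1)) ->
  exists (k : nat) (q : nat -> V),
    [/\ q 0%N = p 0%N, q k = p m & forall i, i < k -> edge L (q i) (q i.+1)].
Proof.
elim: m => [|m ih] h; first by exists 0%N, p.
have [i im|k [q [q0 qk qE]]] := ih; first by apply: h; exact: ltnW.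
have [e|e] := h m (ltnSn m); first by exists k, q; rewrite -e.
exists k.+1, (fun i => if i <= k then q i else p m.+1); split=> //.
  by rewrite ltnn.
move=> i; rewrite ltnS /=; case: (ltngtP i k) => [ik|//|->] _; last by rewrite qk.
exact: qE.
Qed.

Lemma cocompact_subgraph_networkP :
  (calP !=set0 /\
   exists L, [/\ subcomplex L (skeleton 1 K), vertices L = cosets calP,
                 act_invariant (@ltrans G) L, edge_connected L &
                 cocompact (@ltrans G) L])
  <-> @network R (word_space R S) (cosets calP).
Proof.
split=> [[[P PP] [L [LK VL _ Lconn /(cocompact_graphP LK)[n hn]]]]|].
  (* The bound on the length of edges serves as network constant. The cosets xP cover G, and an edge
     path is a chain by [near_unbounded]. *)
  exists n%:R%R; split=> // [|A B cA cB].
    apply/seteqP; split=> // x _; exists (ltrans x P); first by exists x, P.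
    apply: near_set_dist; exists x, x; split=> //; last by rewrite mulVg word_length1.
    by exists 1; [exact: (subgroup1 (sub PP))|rewrite mulg1].
  have [||m [p [p0 pm pE]]] := Lconn A B; rewrite ?VL//.
  have cp i : i <= m -> cosets calP (p i).
    case: i => [_|i im]; first by rewrite p0.
    have [_ e] := pE i im.
    by rewrite -VL; apply: (simplex_vertices e); right.
  exists m, p; split=> // i im; have [_ e] := pE i im.
  apply: near_unbounded; [exact/cp/ltnW|exact: cp| |].
    by apply: hn e _ _; [left|right].
  have [eK _] := LK.2 _ e.
  by apply: (coset_simplex_lstab hP eK); [left|right].
move=> [tau [tau0 cover conn]]; split.
  (* Some coset must cover the point 1, so [calP] has a member. *)
  have : [set: word_space R S] (1 : G) by [].
  by rewrite cover => -[_ [g [P [PP _]]] _]; exists P.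
(* By [unbounded_near], consecutive distinct cosets of a chain are adjacent in this graph. *)
pose n := (Num.truncn tau).+1; exists (fenced_graph (n + n)); split.
- by split=> // s [].
- by [].
- move=> g s [[sK s2] sn]; split; first split.
  + exact: (coset_simplices_ltrans hP).
  + exact: card_le_trans (card_image_le _ _) s2.
  + move=> _ _ [A sA <-] [B sB <-]; exact/near_ltrans/sn.
- move=> A B cA cB; have [m [c [<- <- cc cE]]] := conn A B cA cB.
  apply: edge_path => i im.
  have [|ne] := pselect (c i = c i.+1); first by left.
  have cci := cc i (ltnW im); have ccj := cc i.+1 im.
  have [cn ci] := unbounded_near (truncnS_gt tau) cci ccj (cE i im).
  right; split=> //; split.
    by split; [exact: (coset_simplices2 hP cci ccj)|exact: card_set2_le].
  have ci0 := coset_inhabited hP cci.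
  have cj0 := coset_inhabited hP ccj.
  move=> A' B' [->|->] [->|->] //;
    [exact: near_sets_refl|exact: near_sets_sym|exact: near_sets_refl].
- apply/cocompact_graphP; first by split=> // s [].
  by exists (n + n)%N => s A B [_ h]; exact: h.
Qed.

End CocompactGraphs.

(** * Maximal simplices, their stabilizers and the commensurated core *)

Section Core.
Local Open Scope group_scope.
Local Open Scope card_scope.
Variables (G : groupType) (calP : set (set G)) (hP : group_pair calP).
Implicit Types (g x y : G) (A B P Q : set G) (s t u : set (set G)).
Let K := coset_complex hP.
Let stab := setwise_stab (@ltrans G).

Lemma simplex_infsimplex s : simplices K s -> infsimplex K s.
Proof.
move=> sK; split; first exact: simplex_vertices sK.
by move=> t ts _ t0; exact: simplex_face ts t0.
Qed.

Lemma infsimplex_ltrans g s : infsimplex K s -> infsimplex K (ltrans g @` s).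
Proof.
move=> [sV sK]; split.
  by move=> _ [A /sV cA <-]; exact: (cosets_ltrans g cA).
move=> t ts ft [A tA]; rewrite -(ltrans_setVK g t).
apply: (coset_simplices_ltrans hP); apply: sK; last 2 first.
- exact: finite_image.
- by exists (ltrans g^-1 A); exists A.
- by move=> _ [B /ts[C sC <-] <-]; rewrite ltransK.
Qed.

Lemma maximal_simplex_ltrans g s :
  maximal_simplex K s -> maximal_simplex K (ltrans g @` s).
Proof.
move=> [sI smax]; split; first exact: infsimplex_ltrans.
move=> t tI st; rewrite -(ltrans_setVK g t); congr (_ @` _).
apply: smax; first exact: infsimplex_ltrans.
by rewrite -(ltrans_setK g s); exact: image_subset.
Qed.

Lemma infsimplex_card n s : dim_le n K -> infsimplex K s -> s #<= `I_n.+1.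
Proof.
move=> hn [_ sK]; apply/card_le_ordP => -[//|m] f inj_f sf.
have /hn/card_le_ordP : simplices K (range f).
  apply: sK; [by move=> _ [i _ <-]|exact/finite_image/finite_finset|].
  by exists (f ord0), ord0.
by apply; [exact: inj_f|move=> i; exists i].
Qed.

Lemma infsimplex_finite n s : dim_le n K -> infsimplex K s -> finite_set s.
Proof. by move=> /infsimplex_card h /h sn; apply/finite_set_leP; exists n.+1. Qed.

Lemma infsimplex_simplex n s : dim_le n K -> infsimplex K s -> s !=set0 ->
  simplices K s.
Proof.
move=> hn sI s0; apply: sI.2 => //; exact: infsimplex_finite hn sI.
Qed.

Lemma simplex_in_maximal n s : dim_le n K -> simplices K s ->
  exists2 t, maximal_simplex K t & s `<=` t.
Proof.
move=> hn sK.
(* The dimension bounds these cardinalities, and a simplex containing s of largest cardinality is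
   maximal. *)
pose D k := `[< exists t, [/\ simplices K t, s `<=` t & #|` fset_set t| = k] >].
have Dex : exists k, D k.
  by exists #|` fset_set s|; apply/asboolP; exists s; split.
have Dub k : D k -> k <= n.+1.
  by move=> /asboolP[t [tK _ <-]]; exact/geq_card_fset_set/hn.
have [k /asboolP[t [tK st tk]] kmax] := ex_maxnP Dex Dub.
exists t => //; split; first exact: simplex_infsimplex.
move=> u uI tu; have fu := infsimplex_finite hn uI.
have ft := simplex_finite tK.
have uK : simplices K u.
  apply: (infsimplex_simplex hn) => //.
  by have [A /tu] := simplex_nonempty tK; exists A.
apply/esym/(fset_set_inj ft fu)/eqP.
rewrite eqEfcard tk; apply/andP; split; first by rewrite -fset_set_sub.
apply: kmax; apply/asboolP; exists u; split=> //; exact: subset_trans tu.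
Qed.

(** The empty set satisfies [infsimplex] vacuously, so it is excluded as a maximal simplex only once
    some simplex exists. *)
Lemma maximal_simplex_nonempty s t : simplices K s -> maximal_simplex K t ->
  t !=set0.
Proof.
move=> sK [_ tmax]; apply/set0P/eqP => t0.
have := tmax _ (simplex_infsimplex sK); rewrite t0 => /(_ (sub0set _)) s0.
by have [A] := simplex_nonempty sK; rewrite s0.
Qed.

Lemma infinite_setwise_stab s : simplices K s -> infinite_set (stab s).
Proof.
move=> /(coset_simplicesP hP)[_ _ _]; apply: sub_infinite_set => x xs.
apply/seteqP; split=> [_ [A sA <-]|A sA]; first by rewrite (xs _ sA).
by exists A => //; exact: (xs A sA).
Qed.

Lemma maximal_simplex_stab_inj s t : simplices K s -> simplices K t ->
  maximal_simplex K s -> maximal_simplex K t -> stab s = stab t -> s = t.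
Proof.
move=> sK tK [_ smax] [_ tmax] st.
suff uI : infsimplex K (s `|` t) by rewrite -(smax _ uI)// (tmax _ uI).
apply: simplex_infsimplex; apply/(coset_simplicesP hP); split.
- by move=> A [/(simplex_vertices sK)|/(simplex_vertices tK)].
- by rewrite finite_setU; split; [exact: simplex_finite sK|exact: simplex_finite tK].
- by have [A sA] := simplex_nonempty sK; exists A; left.
- apply: (infinite_pstab (infinite_setwise_stab sK)).
    by rewrite finite_setU; split; [exact: simplex_finite sK|exact: simplex_finite tK].
  move=> x A xs [sA|tA]; [left|right].
    by rewrite -(xs : ltrans x @` s = s); exists A.
  move: xs; rewrite st => xt.
  by rewrite -(xt : ltrans x @` t = t); exists A.
Qed.

Lemma cocompact_finite_dimensional : cocompact (@ltrans G) K ->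
  finite_dimensional K.
Proof.
move=> /cocompact_reps[F [fF FK KF]].
have [s m n mn sm|s Fs|n hn] := @finite_bound _ F (fun s n => s #<= `I_n.+1) fF.
- by apply: card_le_trans sm _; rewrite card_le_II.
- have /finite_set_leP[n sn] := simplex_finite (FK _ Fs).
  by exists n; apply: card_le_trans sn _; rewrite card_le_II.
- by exists n => s /KF[g [t [/hn tn ->]]]; exact: card_le_trans (card_image_le _ _) tn.
Qed.

Let conj_class Q : set (set G) := [set gconj g Q | g in [set: G]].

Lemma conj_class_gconj g Q : conj_class (gconj g Q) = conj_class Q.
Proof.
apply/seteqP; split=> _ [h _ <-].
  by exists (h * g) => //; rewrite gconjM.
by exists (h * g^-1) => //; rewrite gconjM gconjK.
Qed.

(** One stabilizer is picked in each conjugacy class. Simplices in one orbit have conjugate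
    stabilizers, so finitely many orbits give finitely many classes. *)
Lemma cocompact_core : cocompact (@ltrans G) K ->
  exists2 C, commensurated_core hP C & finite_set C.
Proof.
move=> /[dup] /cocompact_finite_dimensional[n hn] /cocompact_reps[F [fF _ KF]].
pose stabs := [set stab s | s in maximal_simplex K].
(* The choice depends only on the class X, which yields uniqueness. The default [set0] is irrelevant
   on classes of stabilizers of maximal simplices, by [repP]. *)
pose rep X := xget set0 (stabs `&` X).
have repP s : maximal_simplex K s ->
    stabs (rep (conj_class (stab s))) /\
    conj_class (stab s) (rep (conj_class (stab s))).
  move=> smax; apply: (@xgetPex _ _ (stabs `&` conj_class (stab s))).
  by exists (stab s); split; [exists s|exists 1 => //; rewrite gconj1].
exists [set rep (conj_class (stab s)) | s in maximal_simplex K].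
  split=> [_ [s /repP[[t tmax <-] _] <-]|s smax]; first by exists t.
  have [_ [g _ e]] := repP s smax.
  exists (rep (conj_class (stab s))); split.
    by split; [exists s|exists g].
  move=> _ [[t tmax <-] [h eh]].
  have [_ [h' _ e']] := repP t tmax.
  congr rep; rewrite -(conj_class_gconj h (stab s)) -eh.
  by rewrite -e' conj_class_gconj.
(* The empty set is added because it is the maximal simplex of an empty complex, and F represents
   only nonempty ones. *)
have fF0 : finite_set (set0 |` F).
  by rewrite finite_setU; split=> //; exact: finite_set1.
apply: (sub_finite_set _ (finite_image (fun s => rep (conj_class (stab s))) fF0)).
move=> _ [s smax <-]; have [s0|s0] := pselect (s !=set0).
  have [g [t [Ft ->]]] := KF s (infsimplex_simplex hn smax.1 s0).
  by exists t; [right|rewrite /stab setwise_stab_ltrans conj_class_gconj].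
exists set0; first by left.
by move: s0 => /set0P/negP/negPn/eqP ->.
Qed.

Lemma core_cocompact n C : dim_le n K -> commensurated_core hP C ->
  finite_set C -> cocompact (@ltrans G) K.
Proof.
move=> hn [Cmax Crep] fC.
have [Q|c hc] := @choice _ _ (fun Q s => C Q -> maximal_simplex K s /\ Q = stab s).
  by have [/Cmax[s smax e]|nC] := pselect (C Q); [exists s|exists set0].
(* [c Q] is a maximal simplex with stabilizer Q. Every simplex will be a translate of a subset of
   one of these finitely many finite sets. *)
apply: (@reps_cocompact _ _ (\bigcup_(Q in C) [set s | s `<=` c Q])).
  apply: bigcup_finite => // Q /hc[[cI _] _].
  exact/finite_subsets/(infsimplex_finite hn).
move=> s sK; have [t tmax st] := simplex_in_maximal hn sK.
have [Q [[CQ [g QE]] _]] := Crep t tmax.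
have [cmax QE'] := hc Q CQ.
have gtmax := maximal_simplex_ltrans g tmax.
(* Both are maximal simplices with stabilizer Q, so [maximal_simplex_stab_inj] identifies them. *)
have e : c Q = ltrans g @` t.
  apply: maximal_simplex_stab_inj => //.
  - exact: (infsimplex_simplex hn cmax.1 (maximal_simplex_nonempty sK cmax)).
  - exact: (infsimplex_simplex hn gtmax.1 (maximal_simplex_nonempty sK gtmax)).
  - by rewrite -QE' QE /stab setwise_stab_ltrans.
exists g^-1, (ltrans g @` s); split; last by rewrite ltrans_setK.
by exists Q => //=; rewrite e; exact: image_subset.
Qed.

Lemma cocompact_coreP : cocompact (@ltrans G) K <->
  finite_height calP /\ exists2 C, commensurated_core hP C & finite_set C.
Proof.
split=> [h|[/(finite_dimensionalP hP)[n hn] [C]]]; last exact: core_cocompact hn.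
split; last exact: cocompact_core.
exact/(finite_dimensionalP hP)/cocompact_finite_dimensional.
Qed.

End Core.

Theorem theorem1p6 (R : realType) (G : groupType)
  (S : finite_generating_set G) (calP : set (set G))
  (hP : group_pair calP) :
  let K := coset_complex hP in
  let cocompactG := cocompact (@ltrans G) in
  [/\ finite_dimensional K <-> finite_height calP,
      bounded_cliques K <-> finite_width calP,
      cocompactG (skeleton 1 K) <-> fenced_infinite_intersections R S calP &
      cocompactG K <->
        finite_height calP /\
        exists2 C, commensurated_core hP C & finite_set C] /\
  [/\ zero_dimensional K <-> almost_malnormal calP &
      (calP !=set0 /\
       exists L, [/\ subcomplex L (skeleton 1 K),
                     vertices L = cosets calP,
                     act_invariant (@ltrans G) L,
                     edge_connected L & cocompactG L])
      <-> @network R (word_space R S) (cosets calP)].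
Proof.
move=> K cocompactG; split; split.
- exact: finite_dimensionalP.
- exact: bounded_cliquesP.
- exact: cocompact_skeletonP.
- exact: cocompact_coreP.
- exact: zero_dimensionalP.
- exact: cocompact_subgraph_networkP.
Qed.
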